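(* Let $L,N\ge 0$ be integers with $2L\le 2N+1$, let $\{\tilde\Phi_\ell\}_{\ell\ge 0}$ be the normalized orthogonal polynomials with respect to the weight function $w$ on $[-1,1]$, let $x_0,\dots,x_N$ be the zeros of $\tilde\Phi_{N+1}$ and $\omega_0,\dots,\omega_N$ the corresponding Gauss quadrature weights. Let $f\in\mathcal C([-1,1])$, $\lambda>0$ and $0\le\mu_0\le\mu_1\le\dots\le\mu_L$. Then the optimal solution $\boldsymbol\beta=[\beta_0,\dots,\beta_L]^T$ of $$\min_{\boldsymbol\beta\in\mathbb R^{L+1}}\ \|\mathbf W^{1/2}(\mathbf A_L\boldsymbol\beta-\mathbf f)\|_2^2+\lambda\|\mathbf R_L\boldsymbol\beta\|_2^2$$ is given by $$\beta_\ell=\frac{1}{1+\lambda\mu_\ell^2}\sum_{j=0}^N\omega_j\tilde\Phi_\ell(x_j)f(x_j),\qquad \ell=0,1,\dots,L.$$ Consequently, the $\ell_2$-regularized approximation polynomial $p^{\ell_2}_{L,N+1}=\sum_{\ell=0}^L\beta_\ell\tilde\Phi_\ell$ is $$p^{\ell_2}_{L,N+1}(x)=\sum_{\ell=0}^L\frac{\tilde\Phi_\ell(x)}{1+\lambda\mu_\ell^2}\sum_{j=0}^N\omega_j\tilde\Phi_\ell(x_j)f(x_j).$$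
   Context: The weight function $w:(-1,1)\to\mathbb R$ is positive with $\int_{-1}^1 w(x)\,dx<\infty$ and $\int_{-1}^1x^iw(x)\,dx<\infty$ for $i=1,2,\dots$. $\tilde\Phi_\ell$ is a polynomial of degree $\ell$, and $\int_{-1}^1w(x)\tilde\Phi_\ell(x)\tilde\Phi_{\ell'}(x)\,dx=\delta_{\ell,\ell'}$. The Gauss quadrature weights $\omega_j>0$ are those for which $\sum_{j=0}^N\omega_jp(x_j)=\int_{-1}^1w(x)p(x)\,dx$ for all polynomials $p$ of degree at most $2N+1$. $\mathbf A_L=[\tilde\Phi_\ell(x_j)]\in\mathbb R^{(N+1)\times(L+1)}$ (row index $j=0,\dots,N$, column index $\ell=0,\dots,L$), $\mathbf W=\mathrm{diag}(\omega_0,\dots,\omega_N)$, $\mathbf f=[f(x_0),\dots,f(x_N)]^T$, $\mathbf R_L=\mathrm{diag}(\mu_0,\dots,\mu_L)$. *)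

(* Defs.v *)
From HB Require Import structures.
From mathcomp Require Import all_boot all_order all_algebra.
From mathcomp Require Import all_classical all_reals all_analysis.
Import Order.TTheory GRing.Theory Num.Theory.
Import numFieldNormedType.Exports.

Set Implicit Arguments.
Unset Strict Implicit.
Unset Printing Implicit Defensive.

Local Open Scope classical_set_scope.
Local Open Scope ring_scope.

(* The weight lives on the open interval: only the values of [w] on ]-1, 1[
   are ever used, and [w] may be unbounded near the endpoints, whence the
   Lebesgue integral.  The case [i = 0] is the integrability of [w] itself. *)
Definition weight_function (R : realType) (w : R -> R) : Prop :=
  (forall x, x \in `]-1, 1[ -> 0 < w x) /\
  (forall i : nat,
     lebesgue_measure.-integrable `]-1, 1[ (fun x => (x ^+ i * w x)%:E)).

(* [size p = l.+1] says that [p] has degree exactly [l]. *)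
Definition orthonormal_polys (R : realType) (w : R -> R)
    (Phi : nat -> {poly R}) : Prop :=
  (forall l, size (Phi l) = l.+1) /\
  (forall l l',
     \int[lebesgue_measure]_(x in `]-1, 1[) (w x * (Phi l).[x] * (Phi l').[x])
     = (l == l')%:R).

Definition enumerates_zeros (R : realType) (n : nat) (p : {poly R})
    (x : 'I_n -> R) : Prop :=
  injective x /\ (forall t, root p t <-> exists j, t = x j).

(* Quadrature on N.+1 nodes, exact in degree at most 2N+1. *)
Definition gauss_weights (R : realType) (N : nat) (w : R -> R)
    (x omega : 'I_N.+1 -> R) : Prop :=
  (forall j, 0 < omega j) /\
  (forall p : {poly R}, (size p <= (2 * N + 1).+1)%N ->
     \sum_(j < N.+1) omega j * p.[x j]
     = \int[lebesgue_measure]_(t in `]-1, 1[) (w t * p.[t])).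

(* The library's norm on matrices is the sup norm. *)
Definition norm2 (R : realType) (n : nat) (v : 'cV[R]_n) : R :=
  Num.sqrt (\sum_(i < n) v i 0 ^+ 2).

Definition design_mx (R : realType) (L N : nat) (Phi : nat -> {poly R})
    (x : 'I_N.+1 -> R) : 'M[R]_(N.+1, L.+1) :=
  \matrix_(j < N.+1, l < L.+1) (Phi l).[x j].

Definition sqrt_weight_mx (R : realType) (N : nat) (omega : 'I_N.+1 -> R) :
    'M[R]_N.+1 :=
  diag_mx (\row_(j < N.+1) Num.sqrt (omega j)).

Definition regularization_mx (R : realType) (L : nat) (mu : 'I_L.+1 -> R) :
    'M[R]_L.+1 :=
  diag_mx (\row_(l < L.+1) mu l).

Definition sample_vec (R : realType) (N : nat) (x : 'I_N.+1 -> R)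
    (f : R -> R) : 'cV[R]_N.+1 :=
  \col_(j < N.+1) f (x j).

Definition l2_objective (R : realType) (L N : nat) (Phi : nat -> {poly R})
    (x omega : 'I_N.+1 -> R) (f : R -> R) (lambda : R) (mu : 'I_L.+1 -> R)
    (beta : 'cV[R]_L.+1) : R :=
  norm2 (sqrt_weight_mx omega
           *m (design_mx L Phi x *m beta - sample_vec x f)) ^+ 2
  + lambda * norm2 (regularization_mx mu *m beta) ^+ 2.

Definition is_minimizer (R : realType) (T : Type) (J : T -> R) (b : T) : Prop :=
  forall c, J b <= J c.

Definition approx_poly (R : realType) (L : nat) (Phi : nat -> {poly R})
    (beta : 'cV[R]_L.+1) : {poly R} :=
  \sum_(l < L.+1) beta l 0 *: Phi l.

(* Main.v *)
Require Import Defs.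
From HB Require Import structures.
From mathcomp Require Import all_boot all_order all_algebra.
From mathcomp Require Import all_classical all_reals all_analysis.
From mathcomp Require Import ring.

(** In the basis [Phi 0, ..., Phi L] the regularized least squares problem
    decouples into [L.+1] scalar quadratic problems.  The product of two basis
    polynomials has degree at most [2 * L <= 2 * N + 1], so Gauss quadrature
    integrates it exactly, and orthonormality for the weight [w] becomes
    orthonormality for the discrete inner product
    [<u, v> = \sum_j omega j * u j * v j] (lemma [gauss_gram]).

    Writing [c l = <Phi l, f>] and [d l = 1 + lambda * mu l ^+ 2], the cross
    terms of the expanded residual vanish and the objective becomes
    [<f, f> + \sum_l (d l * beta l ^+ 2 - 2 * beta l * c l)].  Completing each
    square ([l2_objective_sum_squares]) gives a constant plus
    [\sum_l d l * (beta l - c l / d l) ^+ 2].  Each [d l] is positive, so the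
    unique minimizer is [beta l = c l / d l] ([minimizer_sum_squares]), which
    is the claimed formula; the approximation polynomial is then read off by
    substituting these coefficients. *)

Import Order.TTheory GRing.Theory Num.Theory.
Import numFieldNormedType.Exports.

Set Implicit Arguments.
Unset Strict Implicit.
Unset Printing Implicit Defensive.

Local Open Scope classical_set_scope.
Local Open Scope ring_scope.

Lemma norm2_sqr (R : realType) (n : nat) (v : 'cV[R]_n) :
  norm2 v ^+ 2 = \sum_(i < n) v i 0 ^+ 2.
Proof. by rewrite /norm2 sqr_sqrtr // sumr_ge0 // => i _; exact: sqr_ge0. Qed.

(** The discrete Gram matrix of [Phi 0, ..., Phi L] is the identity, because
    the quadrature is exact on products of two of these polynomials. *)
Lemma gauss_gram (R : realType) (L N : nat) (w : R -> R)
    (Phi : nat -> {poly R}) (x omega : 'I_N.+1 -> R) (l k : 'I_L.+1) :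
  (2 * L <= 2 * N + 1)%N ->
  orthonormal_polys w Phi -> gauss_weights w x omega ->
  \sum_(j < N.+1) omega j * ((Phi l).[x j] * (Phi k).[x j]) = (l == k)%:R.
Proof.
move=> hLN [size_Phi orthPhi] [_ exact_omega].
have size_prod : (size (Phi l * Phi k)%R <= (2 * N + 1).+1)%N.
  apply: leq_trans (size_polyMleq _ _) _.
  rewrite !size_Phi addSn /= addnS ltnS (leq_trans _ hLN) // mul2n -addnn.
  by apply: leq_add; rewrite -ltnS.
have := exact_omega _ size_prod.
under eq_bigr do rewrite hornerM.
move=> ->; rewrite -(orthPhi l k).
by apply: eq_Rintegral => t _; rewrite hornerM mulrA.
Qed.

Lemma l2_objectiveE (R : realType) (L N : nat) (Phi : nat -> {poly R})
    (x omega : 'I_N.+1 -> R) (f : R -> R) (lambda : R) (mu : 'I_L.+1 -> R)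
    (beta : 'cV[R]_L.+1) :
  (forall j, 0 <= omega j) ->
  l2_objective Phi x omega f lambda mu beta =
  \sum_(j < N.+1) omega j *
     (\sum_(l < L.+1) beta l 0 * (Phi l).[x j] - f (x j)) ^+ 2
  + lambda * \sum_(l < L.+1) (mu l * beta l 0) ^+ 2.
Proof.
move=> omega_ge0; rewrite /l2_objective !norm2_sqr; congr (_ + _ * _).
  apply: eq_bigr => j _.
  rewrite /sqrt_weight_mx mul_diag_mx !mxE exprMn sqr_sqrtr //.
  congr (_ * (_ - _) ^+ 2).
  by apply: eq_bigr => l _; rewrite mxE mulrC.
by apply: eq_bigr => l _; rewrite /regularization_mx mul_diag_mx !mxE.
Qed.

(** Expansion of a weighted residual over a family [e] that is orthonormal for
    the weights [omega]: by orthonormality the quadratic part of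
    [\sum_l b l * e l] keeps only its diagonal terms. *)
Lemma orthonormal_residual (R : comNzRingType) (m n : nat) (omega g : 'I_m -> R)
    (e : 'I_n -> 'I_m -> R) (b : 'I_n -> R) :
  (forall l k, \sum_(j < m) omega j * (e l j * e k j) = (l == k)%:R) ->
  \sum_(j < m) omega j * (\sum_(l < n) b l * e l j - g j) ^+ 2 =
  \sum_(l < n) (b l ^+ 2 - 2 * b l * \sum_(j < m) omega j * e l j * g j)
  + \sum_(j < m) omega j * g j ^+ 2.
Proof.
move=> orth_e.
pose s j := \sum_(l < n) b l * e l j.
have quadratic : \sum_(j < m) omega j * s j ^+ 2 = \sum_(l < n) b l ^+ 2.
  transitivity (\sum_(j < m) \sum_(l < n) \sum_(k < n)
      b l * b k * (omega j * (e l j * e k j))).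
    apply: eq_bigr => j _; rewrite expr2 /s mulr_suml mulr_sumr.
    apply: eq_bigr => l _; rewrite mulr_sumr mulr_sumr.
    by apply: eq_bigr => k _; ring.
  rewrite exchange_big; apply: eq_bigr => l _ /=.
  rewrite exchange_big (bigD1 l) //= -mulr_sumr orth_e eqxx mulr1 big1 ?addr0 //.
  by move=> k klN; rewrite -mulr_sumr orth_e eq_sym (negbTE klN) mulr0.
have linear : \sum_(j < m) omega j * s j * g j =
    \sum_(l < n) b l * \sum_(j < m) omega j * e l j * g j.
  transitivity (\sum_(j < m) \sum_(l < n) b l * (omega j * e l j * g j)).
    apply: eq_bigr => j _; rewrite /s mulr_sumr mulr_suml.
    by apply: eq_bigr => l _; ring.
  by rewrite exchange_big; apply: eq_bigr => l _; rewrite -mulr_sumr.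
transitivity (\sum_(j < m) omega j * s j ^+ 2
    - 2 * \sum_(j < m) omega j * s j * g j
    + \sum_(j < m) omega j * g j ^+ 2).
  rewrite mulr_sumr -sumrB -big_split /=.
  by apply: eq_bigr => j _; rewrite -/(s j); ring.
rewrite quadratic linear mulr_sumr -sumrB; congr (_ + _).
by apply: eq_bigr => l _; rewrite mulrA.
Qed.

(** The regularization is diagonal in the same orthonormal basis, so adding it
    only changes the coefficient of [beta l 0 ^+ 2] from [1] to
    [1 + lambda * mu l ^+ 2], and the square can be completed separately for
    each [l]. *)
Lemma l2_objective_sum_squares (R : realType) (L N : nat)
    (Phi : nat -> {poly R}) (x omega : 'I_N.+1 -> R) (f : R -> R) (lambda : R)
    (mu : 'I_L.+1 -> R) (c := fun l : 'I_L.+1 =>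
      \sum_(j < N.+1) omega j * (Phi l).[x j] * f (x j))
    (d := fun l => 1 + lambda * mu l ^+ 2) (beta : 'cV[R]_L.+1) :
  (forall j, 0 <= omega j) ->
  (forall l k : 'I_L.+1,
     \sum_(j < N.+1) omega j * ((Phi l).[x j] * (Phi k).[x j]) = (l == k)%:R) ->
  (forall l, d l != 0) ->
  l2_objective Phi x omega f lambda mu beta =
  (\sum_(j < N.+1) omega j * f (x j) ^+ 2 - \sum_(l < L.+1) c l ^+ 2 / d l)
  + \sum_(l < L.+1) d l * (beta l 0 - c l / d l) ^+ 2.
Proof.
move=> omega_ge0 gram d_neq0; rewrite l2_objectiveE //.
rewrite (orthonormal_residual (fun j => f (x j)) (fun l => beta l 0) gram).
rewrite mulr_sumr addrAC -big_split /= [RHS]addrAC -[RHS]addrA -sumrB addrC.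
congr (_ + _); apply: eq_bigr => l _; rewrite -/(c l).
have -> : d l * (beta l 0 - c l / d l) ^+ 2 - c l ^+ 2 / d l =
    d l * beta l 0 ^+ 2 - 2 * beta l 0 * c l.
  by field; exact: d_neq0.
by rewrite /d; ring.
Qed.

(** The sum of squares vanishes at [m], hence every minimizer makes it vanish,
    and positivity of the [d l] then forces each square to be zero. *)
Lemma minimizer_sum_squares (R : realType) (n : nat) (J : 'cV[R]_n -> R)
    (C : R) (d m : 'I_n -> R) (b : 'cV[R]_n) :
  (forall l, 0 < d l) ->
  (forall a, J a = C + \sum_(l < n) d l * (a l 0 - m l) ^+ 2) ->
  is_minimizer J b <-> forall l, b l 0 = m l.
Proof.
move=> d_gt0 JE.
have term_ge0 (a : 'cV[R]_n) l : 0 <= d l * (a l 0 - m l) ^+ 2.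
  by rewrite mulr_ge0 ?sqr_ge0 // ltW.
have Jm (a : 'cV[R]_n) : (forall l, a l 0 = m l) -> J a = C.
  move=> am; rewrite JE big1 ?addr0 // => l _.
  by rewrite am subrr expr0n mulr0.
split=> [minb l|bm a]; last by rewrite (Jm b bm) JE lerDl sumr_ge0.
have := minb (\col_k m k).
rewrite (Jm (\col_k m k)); last by move=> k; rewrite mxE.
rewrite JE gerDl => sum_le0.
have /eqP sum0 : \sum_(k < n) d k * (b k 0 - m k) ^+ 2 == 0.
  by rewrite eq_le sum_le0 sumr_ge0.
have /eqP : d l * (b l 0 - m l) ^+ 2 = 0.
  exact: psumr_eq0P (fun k _ => term_ge0 b k) sum0 _ isT.
by rewrite mulf_eq0 gt_eqF //= sqrf_eq0 subr_eq0 => /eqP.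
Qed.

Theorem theorem2p1 (R : realType) (L N : nat) (w : R -> R)
    (Phi : nat -> {poly R}) (x omega : 'I_N.+1 -> R) (f : R -> R)
    (lambda : R) (mu : 'I_L.+1 -> R)
    (hLN : (2 * L <= 2 * N + 1)%N)
    (hw : weight_function w)
    (hPhi : orthonormal_polys w Phi)
    (hx : enumerates_zeros (Phi N.+1) x)
    (homega : gauss_weights w x omega)
    (hf : {within `[-1, 1], continuous f})
    (hlambda : 0 < lambda)
    (hmu0 : forall l, 0 <= mu l)
    (hmu : forall l l' : 'I_L.+1, (l <= l')%N -> mu l <= mu l') :
  (forall beta : 'cV[R]_L.+1,
     is_minimizer (l2_objective Phi x omega f lambda mu) beta <->
     forall l : 'I_L.+1,
       beta l 0 = 1 / (1 + lambda * mu l ^+ 2)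
                  * \sum_(j < N.+1) omega j * (Phi l).[x j] * f (x j))
  /\
  (forall beta : 'cV[R]_L.+1,
     is_minimizer (l2_objective Phi x omega f lambda mu) beta ->
     forall t : R,
       (approx_poly Phi beta).[t]
       = \sum_(l < L.+1) (Phi l).[t] / (1 + lambda * mu l ^+ 2)
           * \sum_(j < N.+1) omega j * (Phi l).[x j] * f (x j)).
Proof.
have [omega_gt0 _] := homega.
have d_gt0 l : 0 < 1 + lambda * mu l ^+ 2.
  by rewrite ltr_pwDl // mulr_ge0 ?sqr_ge0 // ltW.
have minimizerE (beta : 'cV[R]_L.+1) :
    is_minimizer (l2_objective Phi x omega f lambda mu) beta <->
    forall l : 'I_L.+1, beta l 0 = 1 / (1 + lambda * mu l ^+ 2)
                  * \sum_(j < N.+1) omega j * (Phi l).[x j] * f (x j).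
  apply: (minimizer_sum_squares _ d_gt0) => a.
  rewrite l2_objective_sum_squares; first last.
  - by move=> l; rewrite gt_eqF.
  - by move=> l k; exact: gauss_gram hLN hPhi homega.
  - by move=> j; exact: ltW.
  by congr (_ + _); apply: eq_bigr => l _; rewrite div1r [_^-1 * _]mulrC.
split=> // beta /minimizerE betaE t.
rewrite /approx_poly horner_sum; apply: eq_bigr => l _.
by rewrite hornerZ betaE div1r; ring.
Qed.
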